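(* Let $G=(V,E)$ be a locally finite graph, let $S\subset V$ be a finite subset whose induced subgraph $G(S)$ is connected, and let $\delta S$ be its boundary and $\bar S=S\cup\delta S$. Let $f:\bar S\to\mathbb{C}$ satisfy the Dirichlet boundary condition, i.e. $f(x)=0$ for all $x\in\delta S$. Then there is a global solution $u(t)=u(\cdot,t):\bar S\to\mathbb{C}$, $t\ge 0$, which can be expressed as $$u(x,t)=\sum_{y\in \bar S}\mathbf{S}_t(x,y)f(y),\qquad \mathbf{S}_t(x,y)=\sum_j e^{-i\lambda_j t}\phi_j(x)\phi_j(y),$$ such that $u$ satisfies the Schrödinger equation $$i\,\partial_t u(x,t)+\Delta u(x,t)=0,\qquad x\in S,\ t>0,$$ with $u(x,0)=f(x)$ for $x\in S$, and such that for all $t\ge 0$ one has the mass conservation $$\|u(t)\|^2=\|f\|^2$$ and the energy conservation $$\int_{\bar S}|\nabla u(t)|^2=\int_{\bar S}|\nabla f|^2 .$$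
   Context: A graph $G=(V,E)$ consists of a vertex set $V$ and an edge set $E$, each edge being an unordered pair of distinct vertices; $x\sim y$ means that there is an edge between $x$ and $y$. $G$ is locally finite in the sense that there is a constant $c>0$ with $\deg(x)=\#\{y\in V: y\sim x\}\le c$ for all $x\in V$. For a finite $S\subset V$, the induced subgraph $G(S)$ has vertex set $S$ and all edges $x\sim y$ with $x,y\in S$. The boundary $\delta S$ is the set of vertices not in $S$ that are adjacent to some vertex in $S$; $\bar S=S\cup\delta S$. For $f:\bar S\to\mathbb{C}$, the Laplacian is $(\Delta f)(x)=\sum_{y:\,y\sim x}(f(y)-f(x))$ for $x\in S$ (all neighbours of $x\in S$ lie in $\bar S$). Moreover $\|f\|^2=\int_{\bar S}|f|^2=\sum_{x\in\bar S}|f(x)|^2$ and $\int_{\bar S}|\nabla f|^2=\|\nabla f\|^2=\sum_{\{x,y\}\subset\bar S,\ x\sim y}|f(x)-f(y)|^2$, the sum being over unordered pairs of adjacent vertices of $\bar S$. The $\lambda_j$ and $\phi_j$ are the finitely many Dirichlet eigenvalues of $-\Delta$ on $S$ and corresponding real-valued eigenfunctions $\phi_j:\bar S\to\mathbb{R}$: $-\Delta\phi_j=\lambda_j\phi_j$ in $S$, $\phi_j=0$ on $\delta S$, $\sum_{x\in\bar S}|\phi_j(x)|^2=1$, chosen so that $\{\phi_j\}$ is an orthonormal basis (with respect to the inner product $\sum_{x\in\bar S}f(x)\overline{g(x)}$) of the space of functions on $\bar S$ vanishing on $\delta S$. *)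

(* Defs.v *)
From HB Require Import structures.
From mathcomp Require Import all_boot all_order all_algebra.
From mathcomp Require Import all_classical all_reals all_analysis.
From mathcomp Require Import complex.

Set Implicit Arguments.
Unset Strict Implicit.
Unset Printing Implicit Defensive.

Import Order.TTheory GRing.Theory Num.Theory.
Import numFieldNormedType.Exports.

Local Open Scope classical_set_scope.
Local Open Scope ring_scope.

(* An edge, i.e. an unordered pair of distinct vertices, is encoded by a
   symmetric irreflexive adjacency relation; V may be infinite. *)
Record graph (V : choiceType) := Graph {
  adj : rel V;
  adj_sym : symmetric adj;
  adj_irr : irreflexive adj }.

Section Graph.
Variables (V : choiceType) (G : graph V).

Definition neighbors (x : V) : set V := [set y | adj G x y].

Definition locally_finite : Prop :=
  exists2 c : nat, (0 < c)%N & forall x, (neighbors x #<= `I_c)%card.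

Definition induced_adj (S : set V) : rel V :=
  fun x y => [&& x \in S, y \in S & adj G x y].

(* The empty set counts as connected here. *)
Definition induced_connected (S : set V) : Prop :=
  forall x y, S x -> S y -> exists2 p : seq V,
    path (induced_adj S) x p & last x p = y.

Definition vboundary (S : set V) : set V :=
  [set x | ~ S x /\ exists2 y, S y & adj G y x].

Definition vclosure (S : set V) : set V := S `|` vboundary S.

(* Functions on S-bar are represented by functions on V whose values outside
   S-bar are irrelevant: every neighbor of a point of S lies in S-bar, and the
   sums below only range over S-bar. A sum over a set, \sum_(x \in A) F x, is
   the usual one as soon as A is finite, which is the case for all the sets
   used here when G is locally finite and S is finite. *)
Definition laplacian (U : zmodType) (f : V -> U) (x : V) : U :=
  \sum_(y \in neighbors x) (f y - f x).

Definition dirichlet (U : zmodType) (S : set V) (f : V -> U) : Prop :=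
  forall x, vboundary S x -> f x = 0.

Section Energy.
Variables (R : realType) (S : set V).

Definition inner (f g : V -> R[i]) : R[i] :=
  \sum_(x \in vclosure S) f x * (g x)^*.

Definition mass (f : V -> R[i]) : R[i] :=
  \sum_(x \in vclosure S) `|f x| ^+ 2.

(* Each unordered pair {x, y} of adjacent vertices of S-bar occurs as the two
   ordered pairs (x, y) and (y, x), whence the factor 1/2. *)
Definition energy (f : V -> R[i]) : R[i] :=
  2^-1 * \sum_(p \in [set p : V * V | [/\ vclosure S p.1, vclosure S p.2
                                        & adj G p.1 p.2]])
           `|f p.1 - f p.2| ^+ 2.

(* The spanning condition is over the complex functions on S-bar vanishing on
   the boundary; linear independence follows from orthonormality. Eigenvalues
   are repeated according to multiplicity. *)
Record dirichlet_eigenbasis (n : nat) (lam : 'I_n -> R) (phi : 'I_n -> V -> R)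
    : Prop := DirichletEigenbasis {
  eigenbasis_eq : forall j x, S x ->
    - laplacian (phi j) x = lam j * phi j x;
  eigenbasis_dirichlet : forall j, dirichlet S (phi j);
  eigenbasis_orthonormal : forall j k,
    inner (fun x => (phi j x)%:C%C) (fun x => (phi k x)%:C%C) = (j == k)%:R;
  eigenbasis_span : forall g : V -> R[i], dirichlet S g ->
    exists c : 'I_n -> R[i], forall x, vclosure S x ->
      g x = \sum_(j < n) c j * (phi j x)%:C%C }.

End Energy.
End Graph.

(* exp (a + i b) = e^a (cos b + i sin b) *)
Definition cexp (R : realType) (z : R[i]) : R[i] :=
  (expR (complex.Re z))%:C%C * (cos (complex.Im z) +i* sin (complex.Im z))%C.

(* Derivative of a complex-valued function of a real variable; R[i]^o carries the
   topology of the modulus but no normed R-module structure, so 'D_v and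
   is_derive are not available for such functions. *)
Definition is_time_derive (R : realType) (w : R -> R[i]) (t : R) (d : R[i])
    : Prop :=
  ((h^-1)%:C%C * (w (t + h) - w t) : R[i]^o) @[h --> (0 : R)^'] --> (d : R[i]^o).

Definition schrodinger_kernel (R : realType) (V : Type) (n : nat)
    (lam : 'I_n -> R) (phi : 'I_n -> V -> R) (t : R) (x y : V) : R[i] :=
  \sum_(j < n) cexp (- 'i%C * (lam j)%:C%C * t%:C%C)
                 * (phi j x)%:C%C * (phi j y)%:C%C.

(* Main.v *)
Require Import Defs.
From HB Require Import structures.
From mathcomp Require Import all_boot all_order all_algebra.
From mathcomp Require Import all_classical all_reals all_analysis.
From mathcomp Require Import finmap complex spectral ring.

Set Implicit Arguments.
Unset Strict Implicit.
Unset Printing Implicit Defensive.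

Import Order.TTheory GRing.Theory Num.Theory.
Import numFieldNormedType.Exports.

Local Open Scope classical_set_scope.
Local Open Scope ring_scope.

(** The Dirichlet Laplacian of [S] is, in the coordinates of the finite set [S],
    a real symmetric matrix: degrees on the diagonal, minus the adjacency
    matrix off it. The real spectral theorem ([real_spectral]) diagonalizes it
    in an orthonormal basis, and extending the eigenvectors by zero to all
    vertices gives a Dirichlet eigenbasis ([dirichlet_eigenbasis_exists]).

    For any eigenbasis, everything is then read off coordinates. A function
    vanishing on the boundary is the sum of its Fourier coefficients
    [c_j = sum_y phi_j(y) f(y)] times the [phi_j] ([expansion_fourier]), and
    summing [f] against the kernel multiplies [c_j] by the phase
    [exp (- i lam_j t)] ([kernel_expansion]). The phases solve the scalar
    equations [i a' = lam_j a], and [- Delta phi_j = lam_j phi_j], so the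
    resulting function solves the Schrodinger equation.

    Both conserved quantities depend on the moduli of the coordinates only: by
    orthonormality the mass of [sum_j a_j phi_j] is [sum_j |a_j|^2]
    ([mass_expansion]), and by Green's identity ([energy_green]) its energy is
    the inner product of [- Delta u] with [u], that is
    [sum_j lam_j |a_j|^2] ([energy_expansion]). Multiplying the coordinates by
    phases of modulus one changes neither. *)

(** * The spectral theorem for real symmetric matrices *)

(** Evaluating [w A w^*] with [A] acting on the left factor or on the right one
    gives [a |w|^2 = a^* |w|^2], where [w^*] is the conjugate transpose. *)
Lemma symmetric_eigenvalue_real (R : rcfType) n (A : 'M[R]_n) (a : R[i])
    (w : 'rV[R[i]]_n) :
  A^T = A -> w != 0 -> w *m map_mx (real_complex R) A = a *: w ->
  a \is Num.real.
Proof.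
move=> Asym w0 wA; set B := map_mx _ A in wA.
pose wc : 'cV[R[i]]_n := (map_mx Num.conj w)^T.
have BH : (map_mx Num.conj B)^T = B.
  apply/matrixP => i j; rewrite !mxE -[in RHS]Asym mxE.
  by apply/CrealP/complex_realP; exists (A j i).
have nE : (w *m wc) 0 0 = \sum_i `|w 0 i| ^+ 2.
  by rewrite mxE; apply: eq_bigr => i _; rewrite !mxE normCK.
have n0 : (w *m wc) 0 0 != 0.
  rewrite nE psumr_eq0; last by move=> i _; rewrite exprn_ge0.
  apply: contraNN w0 => /allP h; apply/eqP/rowP => i; rewrite [RHS]mxE.
  by have := h i; rewrite mem_index_enum expf_eq0 normr_eq0 => /(_ isT)/eqP.
have Bw : B *m wc = a^* *: wc.
  rewrite -[in LHS]BH -trmx_mul -map_mxM wA map_mxZ.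
  by apply/matrixP => i j; rewrite !mxE.
apply/CrealP; apply: (mulIf n0).
transitivity ((w *m B *m wc) 0 0).
  by rewrite -mulmxA Bw -scalemxAr [in RHS]mxE.
by rewrite wA -scalemxAl [in LHS]mxE.
Qed.

(** [B] is the matrix of [A] restricted to the invariant row space of [W], in
    the basis [W]; it need not be symmetric. It has a complex eigenvalue, which
    is one of [A] and hence real; a real root of the characteristic polynomial
    of [B] then has an eigenvector with real coordinates. *)
Lemma symmetric_invariant_eigenvector (R : rcfType) m n (A : 'M[R]_n)
    (W : 'M[R]_(m, n)) (B : 'M[R]_m) :
  A^T = A -> (0 < m)%N -> row_free W -> W *m A = B *m W ->
  exists (a : R) (v : 'rV[R]_m), v != 0 /\ v *m B = a *: v.
Proof.
move=> Asym m0 Wfree WA.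
have [z zB] := eigenvalue_closed (map_mx (real_complex R) B) m0.
have [w wB w0] := eigenvalueP zB.
have zreal : z \is Num.real.
  apply: (@symmetric_eigenvalue_real _ _ A z
            (w *m map_mx (real_complex R) W)) => //.
    by rewrite mulmx_free_eq0 // row_free_map.
  by rewrite -mulmxA -map_mxM WA map_mxM mulmxA wB scalemxAl.
have /complex_realP[a aE] := zreal.
move: zB; rewrite eigenvalue_root_char -map_char_poly aE fmorph_root.
rewrite -eigenvalue_root_char => /eigenvalueP[v vB v0].
by exists a, v.
Qed.

Lemma row_gram_gt0 (R : realDomainType) n (w : 'rV[R]_n) :
  w != 0 -> exists2 N, 0 < N & w *m w^T = N%:M.
Proof.
move=> w0; exists (\sum_i w 0 i ^+ 2).
  rewrite lt_def sumr_ge0 ?andbT; last by move=> i _; rewrite sqr_ge0.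
  rewrite psumr_eq0; last by move=> i _; rewrite sqr_ge0.
  apply: contraNN w0 => /allP h; apply/eqP/rowP => i; rewrite mxE.
  by have := h i; rewrite mem_index_enum sqrf_eq0 => /(_ isT)/eqP.
apply/matrixP => i j; rewrite !ord1 !mxE eqxx mulr1n.
by apply: eq_bigr => l _; rewrite mxE expr2.
Qed.

(** Induction on [k]: the orthogonal complement of the eigenvectors already
    found, which is the kernel of [P^T] acting on rows, is invariant under [A]
    because [A] is symmetric, so it contains a further eigenvector. *)
Lemma orthonormal_eigenrows (R : rcfType) n (A : 'M[R]_n) k :
  A^T = A -> (k <= n)%N ->
  exists (P : 'M[R]_(k, n)) (d : 'rV[R]_k),
    P *m P^T = 1%:M /\ P *m A = diag_mx d *m P.
Proof.
move=> Asym; elim: k => [_|k IHk kn].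
  by exists 0, 0; split; apply/matrixP => -[].
have [P [d [PP PA]]] := IHk (ltnW kn).
pose W := row_base (kermx P^T).
have rW : \rank (kermx P^T) = (n - k)%N.
  rewrite mxrank_ker mxrank_tr; congr (_ - _)%N; apply/eqP.
  by apply/row_freeP; exists P^T.
have WP : W *m P^T = 0.
  by apply/sub_kermxP; rewrite eq_row_base.
have /submxP[B WA] : (W *m A <= W)%MS.
  rewrite [in X in (_ <= X)%MS]/W eq_row_base; apply/sub_kermxP.
  rewrite -mulmxA -[A]Asym -trmx_mul PA trmx_mul tr_diag_mx mulmxA WP.
  by rewrite mul0mx.
have rW0 : (0 < \rank (kermx P^T))%N by rewrite rW subn_gt0.
have [a [v [v0 vB]]] :=
  symmetric_invariant_eigenvector Asym rW0 (row_base_free _) WA.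
pose w := v *m W.
have w0 : w != 0 by rewrite mulmx_free_eq0 // row_base_free.
have wP : w *m P^T = 0 by rewrite -mulmxA WP mulmx0.
have wA : w *m A = a *: w by rewrite -mulmxA WA mulmxA vB scalemxAl.
have [N N0 wwT] := row_gram_gt0 w0.
pose e := (Num.sqrt N)^-1 *: w.
have eP : e *m P^T = 0 by rewrite -scalemxAl wP scaler0.
have ee : e *m e^T = 1%:M.
  rewrite linearZ /= -scalemxAl -scalemxAr scalerA wwT -invfM -expr2.
  by rewrite sqr_sqrtr ?ltW // scale_scalar_mx mulVf ?gt_eqF.
have Pe : P *m e^T = 0.
  by apply: trmx_inj; rewrite trmx_mul trmxK eP trmx0.
have eA : e *m A = a *: e by rewrite -scalemxAl wA !scalerA mulrC.
rewrite -addn1; exists (col_mx P e), (row_mx d a%:M); split.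
  by rewrite tr_col_mx mul_col_row PP Pe eP ee -scalar_mx_block.
rewrite mul_col_mx diag_mx_row mul_block_col !mul0mx addr0 add0r PA eA.
congr col_mx.
apply/matrixP => i j; rewrite !mxE big_ord1 !mxE ord1 !eqxx !mulr1n //.
Qed.

Lemma real_spectral (R : rcfType) n (A : 'M[R]_n) : A^T = A ->
  exists (P : 'M[R]_n) (d : 'rV[R]_n),
    [/\ P *m P^T = 1%:M, P^T *m P = 1%:M & P *m A = diag_mx d *m P].
Proof.
move=> Asym; have [P [d [PP PA]]] := orthonormal_eigenrows Asym (leqnn n).
by exists P, d; split => //; exact: mulmx1C.
Qed.

(** * Finite sums over the closure, and Green's identity *)

Section Closure.
Variables (V : choiceType) (G : graph V) (S : set V).
Hypotheses (lfG : locally_finite G) (finS : finite_set S).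

Lemma finite_neighbors x : finite_set (neighbors G x).
Proof.
have [c _ /(_ x) le_c] := lfG; exact: card_le_finite le_c (finite_II c).
Qed.

Lemma finite_vclosure : finite_set (vclosure G S).
Proof.
rewrite finite_setU; split => //.
apply: (@sub_finite_set _ _ (\bigcup_(x in S) neighbors G x)).
  by move=> y [_ [x Sx xy]]; exists x.
by apply: bigcup_finite => // x _; exact: finite_neighbors.
Qed.

Lemma neighbors_vclosure x : S x -> neighbors G x `<=` vclosure G S.
Proof.
move=> Sx y xy; have [Sy|nSy] := pselect (S y); first by left.
by right; split => //; exists x.
Qed.

Lemma laplacian_sum (U : zmodType) (g : V -> U) x : S x ->
  laplacian G g x =
  \sum_(y <- fset_set (vclosure G S)) (if adj G x y then g y - g x else 0).
Proof.
move=> Sx; rewrite -fsbig_finite; last exact: finite_vclosure.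
rewrite /laplacian -(setIidr (neighbors_vclosure Sx)) fsbig_mkcondr.
by apply: eq_fsbigr => y _; rewrite /= mem_setE.
Qed.

Lemma laplacian_lincomb (K : pzRingType) (U : lmodType K) m (c : 'I_m -> K)
    (g : 'I_m -> V -> U) x : S x ->
  laplacian G (fun y => \sum_j c j *: g j y) x =
  \sum_j c j *: laplacian G (g j) x.
Proof.
move=> Sx; rewrite laplacian_sum //.
under [RHS]eq_bigr => j _ do rewrite laplacian_sum // scaler_sumr.
rewrite exchange_big /=; apply: eq_bigr => y _.
case: ifP => _; last by rewrite big1 // => j _; rewrite scaler0.
by rewrite -sumrB; apply: eq_bigr => j _; rewrite scalerBr.
Qed.

End Closure.

(** A sum over ordered pairs of adjacent vertices may be read with the two ends
    exchanged: this is what makes integration by parts work on a graph. *)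
Lemma adj_swap_sum (V : choiceType) (G : graph V) (K : zmodType) (s : seq V)
    (F : V -> V -> K) :
  \sum_(x <- s) \sum_(y <- s) (if adj G x y then F x y else 0) =
  \sum_(x <- s) \sum_(y <- s) (if adj G x y then F y x else 0).
Proof.
rewrite exchange_big /=; apply: eq_bigr => x _; apply: eq_bigr => y _.
by rewrite adj_sym.
Qed.

Section Green.
Variables (R : realType) (V : choiceType) (G : graph V) (S : set V).
Hypotheses (lfG : locally_finite G) (finS : finite_set S).

Lemma energy_sum (g : V -> R[i]) :
  energy G S g = 2^-1 * \sum_(x <- fset_set (vclosure G S))
    \sum_(y <- fset_set (vclosure G S))
      if adj G x y then `|g x - g y| ^+ 2 else 0.
Proof.
have finX := finite_vclosure lfG finS.
rewrite /energy; congr (_ * _).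
under [RHS]eq_bigr => x _ do rewrite -fsbig_finite //.
rewrite -fsbig_finite // pair_fsbig //.
transitivity (\sum_(p \in (vclosure G S `*` vclosure G S) `&`
                 [set p : V * V | adj G p.1 p.2]) `|g p.1 - g p.2| ^+ 2).
  apply: eq_fsbigl; apply/seteqP.
  by split => [p [? ? ?]|p [[? ?] ?]]; do ?split.
rewrite fsbig_mkcondr; apply: eq_fsbigr => p _.
by rewrite /= mem_setE.
Qed.

(** Green's identity. Expanding [|g x - g y|^2] as
    [(g x - g y) (g x)^* + (g y - g x) (g y)^*] splits the sum over ordered
    pairs into two sums equal by symmetry, which absorbs the factor one half.
    The sum over the neighbors [y] of [x] is then [- Delta g x] for [x] in [S];
    on the boundary, where neighbors of [x] may lie outside the closure, the
    factor [(g x)^*] vanishes. *)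
Lemma energy_green (g : V -> R[i]) : dirichlet G S g ->
  energy G S g = inner G S (fun x => - laplacian G g x) g.
Proof.
move=> g0; have finX := finite_vclosure lfG finS.
rewrite energy_sum /inner fsbig_finite //=.
set X := fset_set _.
transitivity (\sum_(x <- X) \sum_(y <- X)
   if adj G x y then (g x - g y) * (g x)^* else 0).
  have -> : \sum_(x <- X) \sum_(y <- X)
       (if adj G x y then `|g x - g y| ^+ 2 else 0) =
     \sum_(x <- X) \sum_(y <- X)
       (if adj G x y then (g x - g y) * (g x)^* else 0) +
     \sum_(x <- X) \sum_(y <- X)
       (if adj G x y then (g y - g x) * (g y)^* else 0).
    rewrite -big_split; apply: eq_bigr => x _ /=.
    rewrite -big_split; apply: eq_bigr => y _ /=.
    case: ifP => _; last by rewrite addr0.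
    by rewrite normCK rmorphB mulrBr -[in RHS](opprB (g x)) mulNr.
  rewrite -(adj_swap_sum G X (fun x y => (g x - g y) * (g x)^*)).
  by rewrite -mulr2n -[X in _ * X]mulr_natl mulKf // pnatr_eq0.
apply: eq_big_seq => x; rewrite in_fset_set // => /set_mem [Sx|bx].
  rewrite (laplacian_sum lfG finS) // -sumrN mulr_suml; apply: eq_bigr => y _.
  by case: ifP => _; rewrite ?opprB // oppr0 mul0r.
rewrite (g0 x bx) conjC0 mulr0 big1 // => y _.
by case: ifP; rewrite ?mulr0.
Qed.

End Green.

(** * Existence of a Dirichlet eigenbasis *)

Section Existence.
Variables (R : realType) (V : choiceType) (G : graph V) (S : set V).
Hypotheses (lfG : locally_finite G) (finS : finite_set S).

Lemma sum_vclosure_dirichlet (K : nmodType) (F : V -> K) :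
  (forall x, vboundary G S x -> F x = 0) ->
  \sum_(x \in vclosure G S) F x = \sum_(x \in S) F x.
Proof.
move=> F0; apply/esym/fsbig_widen; first by move=> x; left.
by move=> x [[//|bx] _]; exact: F0.
Qed.

Definition degree x := (\sum_(z \in neighbors G x) 1)%N.

(** The formula from which the matrix of the Dirichlet Laplacian is read: the
    degree counts all neighbors, including those on the boundary, while the sum
    sees only neighbors inside [S]. *)
Lemma laplacian_dirichletN (U : zmodType) (g : V -> U) x :
  dirichlet G S g -> S x ->
  - laplacian G g x =
  g x *+ degree x - \sum_(y \in S) (if adj G x y then g y else 0).
Proof.
move=> g0 Sx; have finN := finite_neighbors lfG x.
rewrite -sum_vclosure_dirichlet; last first.
  by move=> y /g0 ->; case: ifP.
have -> : \sum_(y \in vclosure G S) (if adj G x y then g y else 0) =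
          \sum_(y \in neighbors G x) g y.
  rewrite -(setIidr (neighbors_vclosure (G := G) Sx)) fsbig_mkcondr.
  by apply: eq_fsbigr => y _; rewrite /= mem_setE.
rewrite /laplacian /degree !fsbig_finite //= sumrB opprB -sumrMnr.
by congr (_ - _); apply: eq_bigr.
Qed.

(** The rows of the orthogonal matrix [P] diagonalizing the Dirichlet Laplacian
    are the eigenfunctions. [P P^T = 1] is their orthonormality, and
    [P^T P = 1] is the completeness relation that gives the spanning property,
    with coefficients the inner products with [g]. *)
Lemma dirichlet_eigenbasis_exists :
  exists (n : nat) (lam : 'I_n -> R) (phi : 'I_n -> V -> R),
    dirichlet_eigenbasis G S lam phi.
Proof.
have [X SX] := (finite_seqP S).1 finS.
pose s := undup X.
have Ss : S = [set` s].
  by rewrite SX; apply/seteqP; split=> x /=; rewrite mem_undup.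
have us : uniq s := undup_uniq X.
pose vtx := tnth (in_tuple s).
have vtxI : injective vtx by apply/tuple_uniqP.
have Svtx i : S (vtx i) by rewrite Ss /=; exact: mem_tnth.
have vtxS x : S x -> exists i, x = vtx i.
  by rewrite Ss => /= xs; have /tnthP[i ->] : x \in in_tuple s by []; exists i.
have sumS (K : nmodType) (F : V -> K) : \sum_(x \in S) F x = \sum_i F (vtx i).
  by rewrite Ss -fsbig_seq // big_tnth.
pose A : 'M[R]_(size s) := \matrix_(i, j)
  ((i == j)%:R * (degree (vtx i))%:R - (adj G (vtx i) (vtx j))%:R).
have Asym : A^T = A.
  apply/matrixP => i j; rewrite !mxE adj_sym eq_sym.
  by case: eqP => [->|] //=; rewrite !mul0r.
have [P [d [PP PTP PA]]] := real_spectral Asym.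
(* The extension of row [j] by zero outside [S]. *)
pose phi j x := \sum_i P j i * (vtx i == x)%:R.
have phiE j i : phi j (vtx i) = P j i.
  rewrite /phi (bigD1 i) //= eqxx mulr1 big1 ?addr0 // => k ki.
  by rewrite (inj_eq vtxI) (negbTE ki) mulr0.
have phi0 j : dirichlet G S (phi j).
  move=> x [nSx _]; rewrite /phi big1 // => i _.
  by case: eqP => [ix|]; [case: nSx; rewrite -ix | rewrite mulr0].
exists (size s), (fun j => d 0 j), phi; split => //.
- move=> j x /vtxS[i ->]; rewrite laplacian_dirichletN // sumS phiE.
  transitivity ((P *m A) j i); last by rewrite PA mul_diag_mx mxE.
  rewrite mxE; under [RHS]eq_bigr => k _ do rewrite -Asym !mxE mulrBr.
  rewrite sumrB [in RHS](bigD1 i) //= eqxx mul1r mulr_natr [X in _ + X - _]big1.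
    rewrite addr0; congr (_ - _); apply: eq_bigr => k _.
    by rewrite phiE; case: ifP; rewrite ?mulr1 ?mulr0.
  by move=> k /negbTE; rewrite eq_sym => ->; rewrite mul0r mulr0.
- move=> j k; rewrite /inner sum_vclosure_dirichlet; last first.
    by move=> x /phi0 ->; rewrite mul0r.
  rewrite sumS; transitivity (((P *m P^T) j k)%:C%C).
    rewrite mxE rmorph_sum /=; apply: eq_bigr => i _; rewrite !phiE mxE rmorphM.
    by congr (_ * _); apply/CrealP/complex_realP; exists (P k i).
  by rewrite PP mxE rmorph_nat.
- move=> g g0; exists (fun j => \sum_i g (vtx i) * (P j i)%:C%C).
  move=> x [/vtxS[k ->]|bx].
    under eq_bigr => j _ do rewrite mulr_suml.
    rewrite exchange_big /= (bigD1 k) //= [X in _ + X]big1 ?addr0 => [|i ik].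
      under eq_bigr => j _ do rewrite -mulrA.
      rewrite -mulr_sumr.
      transitivity (g (vtx k) * ((P^T *m P) k k)%:C%C).
        by rewrite PTP mxE eqxx mulr1.
      rewrite mxE rmorph_sum /=; congr (_ * _); apply: eq_bigr => j _.
      by rewrite phiE mxE rmorphM.
    under eq_bigr => j _ do rewrite -mulrA.
    rewrite -mulr_sumr.
    transitivity (g (vtx i) * ((P^T *m P) i k)%:C%C); last first.
      by rewrite PTP mxE (negbTE ik) mulr0.
    rewrite mxE rmorph_sum /=; congr (_ * _); apply: eq_bigr => j _.
    by rewrite phiE mxE rmorphM.
  by rewrite g0 // big1 // => j _; rewrite phi0 // mulr0.
Qed.

End Existence.

(** * Time derivatives of complex-valued functions *)

Section TimeDerivative.
Variable R : realType.
Implicit Types (w : R -> R[i]) (t l : R).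

(** The link between the topology of [R] and that of the modulus on [R[i]]:
    positive elements of [R[i]] are real, so both have the same radii. *)
Lemma cvg_real_complex T (F : set_system T) {FF : Filter F}
    (a : T -> R) (b : R) :
  a x @[x --> F] --> b ->
  ((a x)%:C%C : R[i]^o) @[x --> F] --> (b%:C%C : R[i]^o).
Proof.
move=> /cvgrPdist_lt ab; apply/cvgrPdist_lt => e e0.
have /complex_realP[r er] : e \is Num.real by exact: gtr0_real.
move: e0; rewrite er ltcR => r0.
have := ab r r0; apply: filterS => x abx.
by rewrite -rmorphB normc_def /= expr0n addr0 sqrtr_sqr ltcR.
Qed.

Lemma is_time_derive_mulr w t (d c : R[i]) :
  is_time_derive w t d -> is_time_derive (fun s => w s * c) t (d * c).
Proof.
rewrite /is_time_derive => wd.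
by under eq_fun do rewrite -mulrBl mulrA; exact: cvgMr_tmp.
Qed.

Lemma is_time_derive_sum n (w : 'I_n -> R -> R[i]) t (d : 'I_n -> R[i]) :
  (forall j, is_time_derive (w j) t (d j)) ->
  is_time_derive (fun s => \sum_j w j s) t (\sum_j d j).
Proof.
rewrite /is_time_derive => wd.
under eq_fun do rewrite -sumrB mulr_sumr.
apply: (@cvg_big (R[i]^o) _ +%R 0 xpredT) => //.
by move=> x; exact: add_continuous.
Qed.

Lemma is_time_derive_complex (a b : R -> R) t (da db : R) :
  is_derive t 1 a da -> is_derive t 1 b db ->
  is_time_derive (fun s => a s +i* b s)%C t (da +i* db)%C.
Proof.
have H f df : is_derive t 1 f df ->
    ((h^-1 * (f (t + h) - f t))%:C%C : R[i]^o) @[h --> (0 : R)^']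
      --> (df%:C%C : R[i]^o).
  move=> [dfD <-]; apply: cvg_real_complex.
  under eq_fun do rewrite [X in f X]addrC -[X in f (X + _)](mulr1 _).
  exact: dfD.
move=> /H ha /H hb; rewrite /is_time_derive.
have hb' := @cvgMl_tmp _ _ _ (dnbhs_filter _) _ ('i%C : R[i]) _ hb.
have E (x y x' y' h : R) : (h^-1)%:C%C * ((x +i* y) - (x' +i* y'))%C =
    (h^-1 * (x - x'))%:C%C + 'i%C * (h^-1 * (y - y'))%:C%C.
  apply/eqP; rewrite eq_complex /=.
  by rewrite !(mul0r, mul1r, subr0, addr0, add0r) !eqxx.
under eq_fun do rewrite E.
have -> : (da +i* db)%C = da%:C%C + 'i%C * db%:C%C by rewrite [LHS]complexE.
exact: cvgD ha hb'.
Qed.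

Lemma cexp_imaginary l t :
  cexp (- 'i%C * l%:C%C * t%:C%C) = (cos (l * t) +i* - sin (l * t))%C.
Proof.
rewrite /cexp /= !(oppr0, mul0r, mulr0, subr0, addr0, add0r) expR0 mul1r.
by rewrite mulN1r mulNr cosN sinN.
Qed.

Lemma cexp0 l : cexp (- 'i%C * l%:C%C * 0%:C%C) = 1 :> R[i].
Proof. by rewrite cexp_imaginary mulr0 cos0 sin0 oppr0. Qed.

Lemma norm_cexp_imaginary l t : `|cexp (- 'i%C * l%:C%C * t%:C%C)| = 1 :> R[i].
Proof. by rewrite cexp_imaginary normc_def /= sqrrN cos2Dsin2 sqrtr1. Qed.

Lemma is_time_derive_cexp l t :
  is_time_derive (fun s => cexp (- 'i%C * l%:C%C * s%:C%C)) t
    (- 'i%C * l%:C%C * cexp (- 'i%C * l%:C%C * t%:C%C)).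
Proof.
under eq_fun do rewrite cexp_imaginary.
have lin : is_derive t 1 (fun s => l * s) l.
  by apply: is_derive_eq; rewrite scaler1.
have -> : - 'i%C * l%:C%C * cexp (- 'i%C * l%:C%C * t%:C%C) =
    ((- sin (l * t) * l) +i* - (cos (l * t) * l))%C :> R[i].
  rewrite cexp_imaginary; apply/eqP; rewrite eq_complex /=.
  by apply/andP; split; apply/eqP; ring.
exact: is_time_derive_complex.
Qed.

End TimeDerivative.

(** * Expansion in an eigenbasis *)

Section Expansion.
Variables (R : realType) (V : choiceType) (G : graph V) (S : set V).
Hypotheses (lfG : locally_finite G) (finS : finite_set S).
Variables (n : nat) (lam : 'I_n -> R) (phi : 'I_n -> V -> R).
Hypothesis basis : dirichlet_eigenbasis G S lam phi.
Implicit Types (a b : 'I_n -> R[i]) (g : V -> R[i]).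

Definition expansion a : V -> R[i] := fun x => \sum_j a j * (phi j x)%:C%C.

Lemma eq_inner g1 g2 h1 h2 :
  {in vclosure G S, g1 =1 g2} -> {in vclosure G S, h1 =1 h2} ->
  inner G S g1 h1 = inner G S g2 h2.
Proof. by move=> gE hE; apply: eq_fsbigr => x Xx; rewrite gE // hE. Qed.

Lemma eq_energy g h : {in vclosure G S, g =1 h} -> energy G S g = energy G S h.
Proof.
move=> gh; congr (_ * _); apply: eq_fsbigr => p /set_mem[p1 p2 _].
by rewrite !gh //; exact: mem_set.
Qed.

Lemma mass_inner g : mass G S g = inner G S g g.
Proof. by apply: eq_fsbigr => x _; rewrite normCK. Qed.

Lemma inner_expansion a b :
  inner G S (expansion a) (expansion b) = \sum_j a j * (b j)^*.
Proof.
have finX := finite_vclosure lfG finS.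
rewrite /inner fsbig_finite //=.
under eq_bigr => x _.
  rewrite rmorph_sum mulr_suml.
  under eq_bigr => j _ do rewrite mulr_sumr.
  over.
rewrite exchange_big /=; apply: eq_bigr => j _.
rewrite exchange_big /=.
transitivity (\sum_k a j * (b k)^* * (j == k)%:R).
  apply: eq_bigr => k _.
  rewrite -(eigenbasis_orthonormal basis) /inner fsbig_finite //= mulr_sumr.
  by apply: eq_bigr => x _; rewrite rmorphM /=; ring.
rewrite (bigD1 j) //= eqxx mulr1 big1 ?addr0 // => k kj.
by rewrite eq_sym (negbTE kj) mulr0.
Qed.

Lemma dirichlet_expansion a : dirichlet G S (expansion a).
Proof.
move=> x bx; rewrite /expansion big1 // => j _.
by rewrite (eigenbasis_dirichlet basis) // mulr0.
Qed.

Lemma laplacian_expansion a x : S x ->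
  - laplacian G (expansion a) x = expansion (fun j => a j * (lam j)%:C%C) x.
Proof.
move=> Sx.
rewrite (laplacian_lincomb lfG finS (U := R[i]^o) a
           (fun j y => (phi j y)%:C%C)) //.
rewrite -sumrN; apply: eq_bigr => j _.
rewrite -scalerN -mulrA -rmorphM -(eigenbasis_eq basis) //.
rewrite !(laplacian_sum lfG finS) //.
rewrite rmorphN rmorph_sum /=; congr (_ * - _); apply: eq_bigr => y _.
by case: ifP => // _; rewrite rmorphB.
Qed.

Lemma mass_expansion a : mass G S (expansion a) = \sum_j `|a j| ^+ 2.
Proof.
by rewrite mass_inner inner_expansion; apply: eq_bigr => j _; rewrite normCK.
Qed.

(** Green's identity turns the energy into an inner product in which
    [- Delta] acts diagonally; the Laplacian of the expansion is only controlled
    on [S], but the expansion vanishes on the boundary. *)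
Lemma energy_expansion a :
  energy G S (expansion a) = \sum_j (lam j)%:C%C * `|a j| ^+ 2.
Proof.
have da := dirichlet_expansion a.
rewrite (energy_green lfG finS) //.
transitivity
  (inner G S (expansion (fun j => a j * (lam j)%:C%C)) (expansion a)).
  apply: eq_fsbigr => x /set_mem[Sx|bx]; first by rewrite laplacian_expansion.
  by rewrite (da x bx) conjC0 !mulr0.
rewrite inner_expansion; apply: eq_bigr => j _.
by rewrite normCK mulrCA mulrA.
Qed.

Definition fourier_coef g j : R[i] :=
  \sum_(y \in vclosure G S) (phi j y)%:C%C * g y.

(** The spanning property provides some coefficients; orthonormality, applied
    to the expansion of [phi_j] itself, identifies them. *)
Lemma expansion_fourier g : dirichlet G S g ->
  {in vclosure G S, expansion (fourier_coef g) =1 g}.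
Proof.
move=> /(eigenbasis_span basis)[c gE] x /set_mem Xx.
rewrite gE //; apply: eq_bigr => j _; congr (_ * _).
(* The coordinates of [phi j] itself. *)
pose e k : R[i] := (k == j)%:R.
have eE y : expansion e y = (phi j y)%:C%C.
  rewrite /expansion (bigD1 j) //= /e eqxx mul1r big1 ?addr0 // => k /negbTE ->.
  by rewrite mul0r.
transitivity (inner G S (expansion c) (expansion e)).
  apply: eq_fsbigr => y /set_mem Xy; rewrite gE // eE mulrC; congr (_ * _).
  by apply/esym/CrealP/complex_realP; exists (phi j y).
rewrite inner_expansion (bigD1 j) //= /e eqxx conjC1 mulr1.
rewrite big1 ?addr0 // => k /negbTE ->.
by rewrite conjC0 mulr0.
Qed.

Lemma kernel_expansion g t x :
  \sum_(y \in vclosure G S) schrodinger_kernel lam phi t x y * g y =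
  expansion
    (fun j => cexp (- 'i%C * (lam j)%:C%C * t%:C%C) * fourier_coef g j) x.
Proof.
have finX := finite_vclosure lfG finS.
rewrite /expansion /fourier_coef fsbig_finite //=.
under eq_bigr => y _ do rewrite /schrodinger_kernel mulr_suml.
rewrite exchange_big; apply: eq_bigr => j _.
rewrite fsbig_finite //= mulr_sumr mulr_suml; apply: eq_bigr => y _.
ring.
Qed.

End Expansion.

(** * The Schrodinger flow *)

Theorem theorem1 (R : realType) (V : choiceType) (G : graph V) (S : set V)
    (hG : locally_finite G) (hS : finite_set S)
    (hconn : induced_connected G S)
    (f : V -> R[i]) (hf : dirichlet G S f) :
  (exists (n : nat) (lam : 'I_n -> R) (phi : 'I_n -> V -> R),
     dirichlet_eigenbasis G S lam phi) /\
  (forall (n : nat) (lam : 'I_n -> R) (phi : 'I_n -> V -> R),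
     dirichlet_eigenbasis G S lam phi ->
     exists u : R -> V -> R[i],
       [/\ forall t x, 0 <= t -> vclosure G S x ->
             u t x = \sum_(y \in vclosure G S)
                       schrodinger_kernel lam phi t x y * f y,
           forall t x, 0 < t -> S x ->
             exists2 du : R[i], is_time_derive (fun s => u s x) t du
                              & 'i%C * du + laplacian G (u t) x = 0,
           forall x, S x -> u 0 x = f x,
           forall t, 0 <= t -> mass G S (u t) = mass G S f
         & forall t, 0 <= t -> energy G S (u t) = energy G S f]).
Proof.
split; first exact: dirichlet_eigenbasis_exists.
move=> n lam phi basis.
pose c := fourier_coef G S phi f.
pose a t j := cexp (- 'i%C * (lam j)%:C%C * t%:C%C) * c j.
have fE : {in vclosure G S, expansion phi c =1 f}.
  exact: (expansion_fourier hG hS basis).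
have normE t j : `|a t j| = `|c j| by rewrite normrM norm_cexp_imaginary mul1r.
exists (fun t => expansion phi (a t)); split.
- by move=> t x _ _; rewrite (kernel_expansion hG hS).
- move=> t x _ Sx.
  exists (expansion phi (fun j => - 'i%C * (lam j)%:C%C * a t j) x).
    rewrite /expansion; apply: is_time_derive_sum => j.
    rewrite /a (mulrA _ (cexp _)).
    by do 2!apply: is_time_derive_mulr; exact: is_time_derive_cexp.
  rewrite -[laplacian _ _ _]opprK (laplacian_expansion hG hS basis) //.
  apply/eqP; rewrite subr_eq0; apply/eqP.
  rewrite /expansion mulr_sumr; apply: eq_bigr => j _.
  move: (a t j) => z.
  by rewrite !mulrA mulrN -expr2 sqr_i opprK mul1r (mulrC _ z).
- move=> x Sx; rewrite -[RHS]fE; last by apply: mem_set; left.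
  by apply: eq_bigr => j _; rewrite /a cexp0 mul1r.
- move=> t _; rewrite [RHS]mass_inner -(eq_inner fE fE) -mass_inner.
  rewrite !(mass_expansion hG hS basis).
  by apply: eq_bigr => j _; rewrite normE.
- move=> t _; rewrite -[RHS](eq_energy fE).
  rewrite !(energy_expansion hG hS basis).
  by apply: eq_bigr => j _; rewrite normE.
Qed.
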